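(* Let $1\leq k\leq\ell<n$ be integers, put $p=k/n$ and $q=\ell/n$, and let $\mathcal F\subseteq\binom{[n]}k$. Then $$\mu_\ell(\partial_{k\to\ell}\mathcal F)\geq\Theta_{p,q}(\mu_k(\mathcal F)).$$
   Context: $[n]=\{1,\ldots,n\}$ and $\binom{[n]}k$ is the collection of all $k$-element subsets of $[n]$. For $\mathcal F\subseteq\binom{[n]}k$, $\mu_k(\mathcal F)=|\mathcal F|/\binom nk$, and for $k\le \ell\le n$ the upper $\ell$-shadow is $\partial_{k\to\ell}\mathcal F=\{B\in\binom{[n]}\ell: A\subseteq B\text{ for some }A\in\mathcal F\}$. For $0<p\leq q<1$ the function $\Theta_{p,q}:[0,1]\to[0,1]$ is $$\Theta_{p,q}(x)=\begin{cases} x^{\frac{\log q}{\log p}}, &0\leq x\leq p^2,\\ q\left[1-\left(1-\frac{x}{p}\right)^{\frac{\log(1-q)}{\log(1-p)}}\right], &p^2\leq x\leq p,\\ 1-(1-x)^{\frac{\log(1-q)}{\log(1-p)}}, &p\leq x\leq1\end{cases}$$ (the formulas agree at $x=p^2$ and $x=p$). Here $\log$ is the natural logarithm. *)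

(* Defs.v *)
From HB Require Import structures.
From mathcomp Require Import all_boot all_order all_algebra.
From mathcomp Require Import reals exp.

Set Implicit Arguments.
Unset Strict Implicit.
Unset Printing Implicit Defensive.

Import Order.TTheory GRing.Theory Num.Theory.

Local Open Scope ring_scope.

(* [n] is represented by 'I_n = {0, ..., n-1}. *)
Definition ksubsets (n k : nat) : {set {set 'I_n}} := [set A : {set 'I_n} | #|A| == k].

Definition mu (R : realType) (n k : nat) (F : {set {set 'I_n}}) : R :=
  #|F|%:R / 'C(n, k)%:R.

Definition upper_shadow (n l : nat) (F : {set {set 'I_n}}) :
    {set {set 'I_n}} :=
  [set B in ksubsets n l | [exists A in F, A \subset B]].

(* Only meant for 0 < p <= q < 1 and 0 <= x <= 1.  There all the exponents are
   positive and the bases nonnegative, and 0 `^ a = 0 for a != 0. *)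
Definition Theta (R : realType) (p q x : R) : R :=
  if x <= p ^+ 2 then x `^ (ln q / ln p)
  else if x <= p then q * (1 - (1 - x / p) `^ (ln (1 - q) / ln (1 - p)))
  else 1 - (1 - x) `^ (ln (1 - q) / ln (1 - p)).

(* Main.v *)
(* Compressions replacing a set V by a disjoint set U of the same size, with a
   fixed point z in U, do not enlarge the upper shadow when applied to minimal
   pairs (U, V), so one may assume that either every member of F contains z, or
   F contains every k-set through z.  Induction on n then only has to compare
   Theta at p y with the link, and Theta at p + (1 - p) y with the deletion.
   With a = ln q / ln p <= 1 <= b = ln (1 - q) / ln (1 - p), both comparisons
   follow from Theta x >= x^a and Theta x >= 1 - (1 - x)^b, because passing to
   the parameters on n - 1 points decreases a (link) and increases b (both).
   The two lower bounds rest on the fact that y^a - (1 - (1 - y)^b) changes sign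
   only at y = p, i.e. on the monotonicity in t of ln (1 - q^t) / ln (1 - p^t). *)

Require Import Defs.
From mathcomp Require Import all_boot all_order all_algebra.
From mathcomp Require Import reals exp.
From mathcomp Require Import ring lra.
From mathcomp Require boolp classical_sets interval_inference convex.
From mathcomp Require topology normedtype sequences derive realfun hoelder.
Import Order.TTheory GRing.Theory Num.Theory.
Local Open Scope ring_scope.

(* classical_sets shadows names of finset, hence the imports local to a section. *)
Section Calculus.
Import boolp classical_sets interval_inference convex.
Import topology normedtype sequences derive realfun hoelder.
Import numFieldNormedType.Exports.

(** * Convexity and a monotone ratio of logarithms *)

Lemma powR_le_chord (R : realType) (b s x y : R) : 1 <= b -> 0 <= s <= 1 ->
  0 <= x -> 0 <= y ->
  (s * x + (1 - s) * y) `^ b <= s * x `^ b + (1 - s) * y `^ b.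
Proof.
move=> b1 s01 x0 y0.
case/andP: s01 => s0 s1.
have inP (z : R) : 0 <= z -> z \in `[0, +oo[%classic by move=> z0; rewrite inE /= in_itv /= z0.
have := convex_powR b1 (Itv01 s0 s1) (inP x x0) (inP y y0).
by rewrite !convRE.
Qed.

(** The quotient at v is the slope of the chord of [ln] from v to 1, so concavity applies. *)
Lemma neg_ln_slope_nincr (R : realType) (w v : R) : 0 < w -> w <= v -> v < 1 ->
  - ln v / (1 - v) <= - ln w / (1 - w).
Proof.
move=> w0 wv v1.
have w1 : 0 < 1 - w by lra.
have v1' : 0 < 1 - v by lra.
have t0 : 0 <= (1 - v) / (1 - w) by rewrite divr_ge0 ?ltW.
have t1 : (1 - v) / (1 - w) <= 1 by rewrite ler_pdivrMr // mul1r; lra.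
have := concave_ln (Itv01 t0 t1) w0 ltr01.
rewrite !convRE /= ln1 mulr0 addr0 mulr1 => H.
have E : (1 - v) / (1 - w) * w + (1 - (1 - v) / (1 - w)) = v by field; lra.
rewrite /unstable.onem E in H.
rewrite ler_pdivrMr // mulrAC -mulrA mulNr lerN2 mulrC; exact: H.
Qed.

(* The two factors on the right, at x = expR (c * t), are both nonincreasing
   in x; this is what makes the ratio in [ln_1B_powR_ratio] monotone. *)
Lemma derive_ln_neg_ln_1B_expR (R : realType) (c t : R) : c < 0 -> 0 < t ->
  is_derive t (1 : R) (fun u : R => ln (- ln (1 - expR (c * u))))
   (- t^-1 * ((- ln (expR (c * t)) / (1 - expR (c * t))) *
          (expR (c * t) / - ln (1 - expR (c * t))))).
Proof.
move=> c0 t0.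
have x1 : expR (c * t) < 1 by rewrite expR_lt1 nmulr_rlt0.
have x0 := expR_gt0 (c * t).
have y0 : 0 < 1 - expR (c * t) by lra.
have l0 : 0 < - ln (1 - expR (c * t)) by rewrite oppr_gt0 ln_lt0 //; lra.
have d1 : is_derive t (1 : R) (fun u : R => c * u) c.
  apply: is_derive_eq; by rewrite ?scaler1 ?scaler0 ?addr0 /= ?mulr1.
have d2 : is_derive t (1 : R) (fun u : R => expR (c * u)) (expR (c * t) * c).
  exact: (is_derive1_comp (is_derive_expR _) d1).
have d3 : is_derive t (1 : R) (fun u : R => 1 - expR (c * u)) (- (expR (c * t) * c)).
  by rewrite -[X in is_derive _ _ _ X]sub0r; apply: is_deriveB.
have d4 := @is_derive1_comp _ (@ln R) (fun u => 1 - expR (c * u)) _ _ _ (is_derive1_ln y0) d3.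
have d5 := is_deriveN d4.
have d6 := @is_derive1_comp _ (@ln R) (fun u => - ln (1 - expR (c * u))) _ _ _ (is_derive1_ln l0) d5.
apply: (is_derive_eq d6).
rewrite expRK; field.
by rewrite -oppr_eq0 !gt_eqF.
Qed.

(** The logarithm [G] of ln (1 - q^t) / ln (1 - p^t) has derivative (h(p^t) - h(q^t)) / t, where
    h(x) is the product of -ln x / (1 - x) and x / -ln (1 - x). Both factors are nonincreasing, so
    the ratio is nondecreasing in t. *)
Lemma ln_1B_powR_ratio (R : realType) (p q s t : R) :
  0 < p -> p <= q -> q < 1 -> 0 < s -> s <= t ->
  ln (1 - q `^ s) * ln (1 - p `^ t) <= ln (1 - q `^ t) * ln (1 - p `^ s).
Proof.
move=> p0 pq q1 s0 st.
have q0 : 0 < q by lra.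
have lp0 : ln p < 0 by rewrite ln_lt0 //; lra.
have lq0 : ln q < 0 by rewrite ln_lt0 //; lra.
have lpq : ln p <= ln q by rewrite ler_ln.
pose H c (u : R) : R := ln (- ln (1 - expR (c * u))).
pose G := fun u => H (ln q) u - H (ln p) u.
have dG (u : R) : 0 < u -> is_derive u (1 : R) G
   ((- u^-1 * ((- ln (expR (ln q * u)) / (1 - expR (ln q * u))) *
          (expR (ln q * u) / - ln (1 - expR (ln q * u)))))
   - (- u^-1 * ((- ln (expR (ln p * u)) / (1 - expR (ln p * u))) *
          (expR (ln p * u) / - ln (1 - expR (ln p * u)))))).
  by move=> u0; apply: is_deriveB; apply: derive_ln_neg_ln_1B_expR.
have pw (x u : R) : 0 < x -> x `^ u = expR (ln x * u).
  by move=> x0; rewrite /powR gt_eqF // mulrC.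
have pos (c u : R) : c < 0 -> 0 < u -> 0 < - ln (1 - expR (c * u)).
  move=> c0 u0; have ? := expR_gt0 (c * u).
  have ? : expR (c * u) < 1 by rewrite expR_lt1 nmulr_rlt0.
  by rewrite oppr_gt0 ln_lt0 //; lra.
have GG : G s <= G t.
  have [->//|sNt] := eqVneq s t.
  have cG : {within `[s, t], continuous G}%classic.
    apply: continuous_in_subspaceT => u; rewrite inE /= in_itv /= => /andP[su _].
    apply: differentiable_continuous; apply/derivable1_diffP.
    by have [] := dG u (lt_le_trans s0 su).
  apply: (@ger0_derive1_le_cc _ G s t) => //; last 2 first.
  - by rewrite in_itv /= lexx.
  - by rewrite in_itv /= lexx st.
  - move=> u; rewrite in_itv /= => /andP[su _].
    by have [] := dG u (lt_trans s0 su).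
  - move=> u; rewrite in_itv /= => /andP[su _].
    have u0 := lt_trans s0 su.
    rewrite derive1E; have [_ ->] := dG u u0.
    rewrite -mulrBr mulNr oppr_ge0 pmulr_rle0 ?invr_gt0 // subr_le0.
    have ly := pos _ u lq0 u0; have lx := pos _ u lp0 u0.
    move: ly lx; set y := expR (ln q * u); set x := expR (ln p * u) => ly lx.
    have x0 : 0 < x by exact: expR_gt0.
    have xy : x <= y by rewrite ler_expR ler_pM2r.
    have y1 : y < 1 by rewrite expR_lt1 nmulr_rlt0.
    apply: ler_pM.
    + by rewrite divr_ge0 //; [rewrite oppr_ge0 ln_le0 ?ltW | lra].
    + by rewrite divr_ge0 // ltW //; lra.
    + by apply: neg_ln_slope_nincr.
    (* The second factor is the inverse of the chord slope at 1 - x, so the same lemma applies to 1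
       - y <= 1 - x. *)
    + rewrite -[X in _ <= X]invf_div -[X in X <= _]invf_div lef_pV2.
      * have := @neg_ln_slope_nincr _ (1 - y) (1 - x).
        have -> : 1 - (1 - y) = y by ring.
        have -> : 1 - (1 - x) = x by ring.
        by rewrite subr_gt0 lerD2l lerN2 ltrBlDr ltrDl; apply.
      * by rewrite posrE divr_gt0 // (lt_le_trans x0 xy).
      * by rewrite posrE divr_gt0.
have t0 := lt_le_trans s0 st.
move: GG; rewrite /G /H lerBlDr addrAC lerBrDr -!lnM ?posrE ?pos //.
rewrite ler_ln ?posrE ?mulr_gt0 ?pos // !mulrNN !pw //.
Qed.

End Calculus.

(** * Comparison of power curves *)

Lemma powR_ln_ratio (R : realType) (x y : R) : 0 < x < 1 -> 0 < y ->
  x `^ (ln y / ln x) = y.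
Proof.
move=> /andP[x0 x1] y0.
rewrite /powR gt_eqF // divfK ?lnK // lt_eqF //.
by apply: ln_lt0; rewrite x0.
Qed.

Lemma ln_ratio_gt0 (R : realType) (x y : R) : 0 < x < 1 -> 0 < y < 1 ->
  0 < ln y / ln x.
Proof. by move=> x01 y01; rewrite -mulrNN -invrN divr_gt0 // oppr_gt0 ln_lt0. Qed.

Lemma ln_ratio_le1 (R : realType) (x y : R) : 0 < x -> x <= y -> y < 1 ->
  ln y / ln x <= 1.
Proof.
move=> x0 xy y1; have lx : ln x < 0 by rewrite ln_lt0 // x0 (le_lt_trans xy).
by rewrite ler_ndivrMr // mul1r ler_ln // posrE (lt_le_trans x0).
Qed.

Lemma ln_ratio_ge1 (R : realType) (x y : R) : 0 < y -> y <= x -> x < 1 ->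
  1 <= ln y / ln x.
Proof.
move=> y0 yx x1; have x0 := lt_le_trans y0 yx.
have lx : ln x < 0 by rewrite ln_lt0 // x0.
by rewrite ler_ndivlMr // mul1r ler_ln.
Qed.

Lemma powR_lt1 (R : realType) (x a : R) : 0 < x < 1 -> 0 < a -> x `^ a < 1.
Proof.
move=> /andP[x0 x1] a0; rewrite /powR gt_eqF // expR_lt1.
by rewrite pmulr_rlt0 // ln_lt0 // x0.
Qed.

(* The curves y |-> y^a and y |-> 1 - (1 - y)^b meet at 0, p and 1, and cross at p. *)
Lemma compl_powR_le (R : realType) (p a b y : R) : 0 < p < 1 -> 0 < a <= 1 ->
  (1 - p) `^ b = 1 - p `^ a ->
  0 <= y <= p -> 1 - (1 - y) `^ b <= y `^ a.
Proof.
move=> /[dup] p01 /andP[p0 p1] /andP[a0 a1] hb /andP[].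
rewrite le_eqVlt => /predU1P[<- _|y0 yp].
  by rewrite subr0 powR1 subrr powR_ge0.
have y1 : y < 1 by lra.
have pa1 : p `^ a < 1 by exact: powR_lt1.
have ya1 : y `^ a < 1 by rewrite powR_lt1 // y0.
have ppa : p <= p `^ a by rewrite ger1_powR // p0 ltW.
have t1 : 1 <= ln y / ln p by exact: ln_ratio_ge1.
have py : p `^ (ln y / ln p) = y by exact: powR_ln_ratio.
(* Here y = p^t with t >= 1. By [hb] the ratio ln (1 - p^(a t)) / ln (1 - p^t) equals b at t = 1, so
   at t it is at least b. *)
have := ln_1B_powR_ratio _ p (p `^ a) 1 _ p0 ppa pa1 ltr01 t1.
rewrite (powRAC p a (ln y / ln p)) py !powRr1 ?powR_ge0 ?(ltW p0) // -hb ln_powR mulrAC.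
rewrite ler_nM2r; last by rewrite ln_lt0 //; lra.
have yb0 : 0 < (1 - y) `^ b by rewrite powR_gt0 // subr_gt0.
rewrite -ln_powR ler_ln ?posrE ?subr_gt0 //; lra.
Qed.

(** Again y = p^t, now with t <= 1, so the ratio is at most b. At y = 1 the condition [b != 0] gives
    0^b = 0. *)
Lemma compl_powR_ge (R : realType) (p a b y : R) : 0 < p < 1 -> 0 < a <= 1 ->
  (1 - p) `^ b = 1 - p `^ a -> b != 0 ->
  p <= y <= 1 -> y `^ a <= 1 - (1 - y) `^ b.
Proof.
move=> /[dup] p01 /andP[p0 p1] /andP[a0 a1] hb b0 /andP[py].
rewrite le_eqVlt => /predU1P[->|y1].
  by rewrite subrr powR0 // subr0 powR1.
have y0 : 0 < y by lra.
have pa1 : p `^ a < 1 by exact: powR_lt1.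
have ya1 : y `^ a < 1 by rewrite powR_lt1 // y0.
have ppa : p <= p `^ a by rewrite ger1_powR // p0 ltW.
have t1 : ln y / ln p <= 1 by exact: ln_ratio_le1.
have t0 : 0 < ln y / ln p by rewrite ln_ratio_gt0 // y0.
have pyE : p `^ (ln y / ln p) = y by exact: powR_ln_ratio.
have := ln_1B_powR_ratio _ p (p `^ a) _ 1 p0 ppa pa1 t0 t1.
rewrite (powRAC p a (ln y / ln p)) pyE !powRr1 ?powR_ge0 ?(ltW p0) // -hb ln_powR [leRHS]mulrAC.
rewrite ler_nM2r; last by rewrite ln_lt0 //; lra.
have yb0 : 0 < (1 - y) `^ b by rewrite powR_gt0 // subr_gt0.
rewrite -ln_powR ler_ln ?posrE ?subr_gt0 //; lra.
Qed.

(* {x, y} is majorized by {x + y - xy, xy}. *)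
Lemma powR_add_le (R : realType) (b x y : R) : 1 <= b ->
  0 <= x <= 1 -> 0 <= y <= 1 ->
  x `^ b + y `^ b <= (x + y - x * y) `^ b + (x * y) `^ b.
Proof.
move=> b1 /andP[x0 x1] /andP[y0 y1].
have m0 : 0 <= x * y by rewrite mulr_ge0.
have [M|mM] := leP (x + y - x * y) (x * y).
  (* Degenerate case: two nonnegative terms have a sum <= 0, so both vanish and x = x y = y. *)
  have xy : x * (1 - y) + y * (1 - x) <= 0 by lra.
  have x1y : 0 <= x * (1 - y) by rewrite mulr_ge0 // subr_ge0.
  have y1x : 0 <= y * (1 - x) by rewrite mulr_ge0 // subr_ge0.
  have -> : x * y = x by lra.
  by rewrite [x + y - x]addrAC subrr add0r addrC.
set M := x + y - x * y; set m := x * y.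
have d0 : 0 < M - m by rewrite subr_gt0.
have xm : m <= x by rewrite /m ler_piMr.
have ym : m <= y by rewrite /m ler_piMl.
(* The weight on M that yields x; as x + y = M + m, the weight 1 - s yields y. *)
pose s := (x - m) / (M - m).
have s01 : 0 <= s <= 1.
  have -> /= : 0 <= s by rewrite divr_ge0 ?subr_ge0 // -subr_ge0 ltW.
  rewrite ler_pdivrMr // mul1r lerD2r /M.
  by rewrite -addrA lerDl subr_ge0.
have s01' : 0 <= 1 - s <= 1 by lra.
have M0 : 0 <= M by rewrite (le_trans m0) // -subr_ge0 ltW.
have := powR_le_chord _ _ _ M m b1 s01 M0 m0.
have := powR_le_chord _ _ _ M m b1 s01' M0 m0.
have -> : s * M + (1 - s) * m = x by rewrite /s; field; lra.
have -> : (1 - s) * M + (1 - (1 - s)) * m = y.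
  by rewrite /s /M -/m; field; rewrite -/m gt_eqF.
lra.
Qed.

(** * Lower bounds for Theta *)

Section ThetaBounds.
Variables (R : realType) (p q : R).
Hypotheses (p0 : 0 < p) (pq : p <= q) (q1 : q < 1).
Let a := ln q / ln p.
Let b := ln (1 - q) / ln (1 - p).

Let a01 : 0 < a <= 1.
Proof.
apply/andP; split; last exact: ln_ratio_le1.
by apply: ln_ratio_gt0; [move: p0 pq q1|move: p0 pq q1]; lra.
Qed.

Let b1 : 1 <= b.
Proof. by move: (p0) (pq) (q1) => ? ? ?; apply: ln_ratio_ge1; lra. Qed.

Let pa : p `^ a = q.
Proof. by move: (p0) (pq) (q1) => ? ? ?; apply: powR_ln_ratio; lra. Qed.

Let pb : (1 - p) `^ b = 1 - q.
Proof. by move: (p0) (pq) (q1) => ? ? ?; apply: powR_ln_ratio; lra. Qed.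

Let b0 : b != 0. Proof. by move: b1; lra. Qed.

(** As q = p^a, dividing the middle branch by q leaves [compl_powR_ge] at x / p, which lies in
    [p, 1]; the last branch is [compl_powR_ge] at x. *)
Lemma Theta_ge_powR (x : R) : 0 <= x <= 1 -> x `^ a <= Theta p q x.
Proof.
move: (p0) (pq) (q1) (b1) => ? ? ? ?.
move=> /andP[x0 x1]; rewrite /Theta -/a -/b.
have [//|px] := leP x (p ^+ 2); have [xp|xp] := leP x p.
- have y01 : p <= x / p <= 1.
    by rewrite ler_pdivlMr // -expr2 ltW // ler_pdivrMr // mul1r.
  have -> : x `^ a = q * (x / p) `^ a.
    rewrite -pa -powRM ?(ltW p0) //; last by lra.
    by rewrite mulrCA divff ?mulr1 // gt_eqF.
  rewrite ler_pM2l; last by lra.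
  by apply: (@compl_powR_ge _ p) => //; rewrite ?pa //; lra.
- by apply: (@compl_powR_ge _ p); rewrite ?pa //; lra.
Qed.

(** On the first branch x <= p and [compl_powR_le] applies. On the middle one, with x = p y,
    [powR_add_le] for 1 - p and 1 - y reads 1 - q + (1 - y)^b <= (1 - x)^b + (1 - q) (1 - y)^b. *)
Lemma Theta_ge_compl_powR (x : R) : 0 <= x <= 1 ->
  1 - (1 - x) `^ b <= Theta p q x.
Proof.
move: (p0) (pq) (q1) (b1) => ? ? ? ?.
move=> /andP[x0 x1]; rewrite /Theta -/a -/b.
have [px|px] := leP x (p ^+ 2); [|have [xp|//] := leP x p].
- apply: (@compl_powR_le _ p); rewrite ?pa //; first by lra.
  by rewrite x0 (le_trans px) // expr2 ler_piMl //; lra.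
- set y := x / p.
  have y01 : 0 <= y <= 1.
    by rewrite divr_ge0 ?(ltW p0) // ler_pdivrMr // mul1r.
  have xE : x = p * y by rewrite /y mulrCA divff ?mulr1 // gt_eqF.
  have := powR_add_le _ b (1 - p) (1 - y) b1.
  have -> : 1 - p + (1 - y) - (1 - p) * (1 - y) = 1 - x by rewrite xE; ring.
  rewrite powRM; [|lra|lra].
  move=> /(_ ltac:(lra) ltac:(lra)); rewrite pb; lra.
Qed.

Lemma Theta_at_p : Theta p q p = q.
Proof.
move: (p0) (pq) (q1) => ? ? ?.
rewrite /Theta -/b lexx leNgt expr2 gtr_pMl //.
have -> : p < 1 by lra.
by rewrite divff ?gt_eqF // subrr powR0 // subr0 mulr1.
Qed.

Lemma Theta_above_p (y : R) : 0 <= y <= 1 ->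
  Theta p q (p + (1 - p) * y) = q + (1 - q) * (1 - (1 - y) `^ b).
Proof.
move: (p0) (pq) (q1) (b1) => ? ? ? ?.
move=> /andP[y0 y1]; have [->|yn0] := eqVneq y 0.
  by rewrite mulr0 addr0 Theta_at_p subr0 powR1 subrr mulr0 addr0.
have xp : p < p + (1 - p) * y by rewrite ltrDl mulr_gt0 ?lt_neqAle 1?eq_sym ?yn0 //; lra.
rewrite /Theta -/b leNgt (lt_trans _ xp) /=; last by rewrite expr2 gtr_pMl //; lra.
rewrite leNgt xp /=.
have -> : 1 - (p + (1 - p) * y) = (1 - p) * (1 - y) by ring.
rewrite powRM ?pb; [ring|lra|lra].
Qed.

(** Used with y the measure of the link when every member contains the chosen point. *)
Lemma Theta_mul_p (y : R) : 0 <= y <= 1 ->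
  Theta p q (p * y) = q * (if y <= p then y `^ a else 1 - (1 - y) `^ b).
Proof.
move: (p0) (pq) (q1) (b1) => ? ? ? ?.
move=> /andP[y0 y1]; rewrite /Theta -/a -/b expr2 ler_pM2l // ger_pMr // y1.
case: ifP => _; first by rewrite powRM ?pa // ltW.
by rewrite mulrAC divff ?mul1r // gt_eqF.
Qed.

Lemma Theta_le1 (y : R) : p <= y -> Theta p q y <= 1.
Proof.
move: (p0) (pq) (q1) => ? ? ?.
rewrite le_eqVlt => /predU1P[<-|py]; first by rewrite Theta_at_p ltW.
have p2y : p ^+ 2 < y by rewrite (lt_trans _ py) // expr2 gtr_pMl //; lra.
by rewrite /Theta !ifN -?ltNge //= lerBlDr lerDl powR_ge0.
Qed.

Lemma Theta0 : Theta p q 0 = 0.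
Proof. by rewrite /Theta sqr_ge0 powR0 //; case/andP: a01 => /gt_eqF->. Qed.

End ThetaBounds.

(** * Passing to the parameters on n - 1 points *)

Lemma ln_ratio_le (R : realType) (x y c : R) : 0 < x < 1 -> x `^ c <= y ->
  ln y / ln x <= c.
Proof.
move=> /andP[x0 x1] xy; have xc0 : 0 < x `^ c by rewrite powR_gt0.
rewrite ler_ndivrMr; last by rewrite ln_lt0 // x0.
by rewrite -ln_powR ler_ln // posrE (lt_le_trans xc0).
Qed.

Lemma ln_ratio_ge (R : realType) (x y c : R) : 0 < x < 1 -> 0 < y ->
  y <= x `^ c -> c <= ln y / ln x.
Proof.
move=> /andP[x0 x1] y0 xy.
rewrite ler_ndivlMr; last by rewrite ln_lt0 // x0.
by rewrite -ln_powR ler_ln // posrE powR_gt0.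
Qed.

(** Concavity of x^a follows from the convexity of its inverse x^(1/a). *)
Lemma powR_ge_chord1 (R : realType) (a t x : R) : 0 < a <= 1 -> 0 <= t <= 1 ->
  0 <= x -> t * x `^ a + (1 - t) <= (t * x + (1 - t)) `^ a.
Proof.
move=> /andP[a0 a1] t01 x0.
have aV : 1 <= a^-1 by rewrite invf_ge1.
have := powR_le_chord _ _ _ (x `^ a) 1 aV t01 (powR_ge0 _ _) ler01.
rewrite -powRrM divff ?gt_eqF // powRr1 // powR1 !mulr1 => H.
have z0 : 0 <= t * x `^ a + (1 - t).
  by rewrite addr_ge0 // ?mulr_ge0 ?powR_ge0 //; lra.
have w0 : 0 <= t * x + (1 - t) by rewrite addr_ge0 // ?mulr_ge0 //; lra.
have := ge0_ler_powR (ltW a0) (powR_ge0 _ _) w0 H.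
by rewrite -powRrM mulVf ?gt_eqF // powRr1.
Qed.

Lemma compl_powR_mono (R : realType) (b c y : R) : b <= c -> 0 < b ->
  0 <= y <= 1 -> (1 - y) `^ c <= (1 - y) `^ b.
Proof.
move=> bc b0 /andP[y0]; rewrite le_eqVlt => /predU1P[->|y1].
  by rewrite subrr !powR0 // gt_eqF // (lt_le_trans b0).
by apply: ger_powR => //; lra.
Qed.

(* The case where all the sets contain a given point: with s = n / (n - 1),
   the parameters p' = (k - 1) / (n - 1), q' = (l - 1) / (n - 1) of the link
   satisfy 1 - p' = s (1 - p) and 1 - q' = s (1 - q). *)
Lemma Theta_mul_p_le (R : realType) (p q p' q' s y : R) :
  0 < p' -> p' <= q' -> q' < 1 -> 1 <= s -> 1 - p' = s * (1 - p) ->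
  1 - q' = s * (1 - q) -> 0 <= y <= 1 ->
  Theta p q (p * y) <= q * Theta p' q' y.
Proof.
move=> p'0 pq' q'1 s1 ps qs /[dup] y01 /andP[y0 y1].
have s0 : 0 < s by lra.
have sV0 : 0 < s^-1 by rewrite invr_gt0.
have sV1 : s^-1 <= 1 by rewrite invf_le1.
have pE : p = s^-1 * p' + (1 - s^-1).
  have -> : p' = 1 - s * (1 - p) by lra.
  by field; rewrite gt_eqF.
have qE : q = s^-1 * q' + (1 - s^-1).
  have -> : q' = 1 - s * (1 - q) by lra.
  by field; rewrite gt_eqF.
have p1 : p < 1 by rewrite -subr_gt0 -(pmulr_rgt0 _ s0) -ps; lra.
have q1 : q < 1 by rewrite -subr_gt0 -(pmulr_rgt0 _ s0) -qs; lra.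
have p0 : 0 < p by rewrite pE ltr_wpDr ?subr_ge0 // mulr_gt0.
have pq : p <= q by rewrite pE qE lerD2r ler_pM2l.
have q0 : 0 < q by lra.
rewrite Theta_mul_p // ler_pM2l //; set a := ln q / ln p; set b := ln (1 - q) / ln (1 - p).
have a0 : 0 < a by apply: ln_ratio_gt0; lra.
have a1 : a <= 1 by apply: ln_ratio_le1.
have b1 : 1 <= b by apply: ln_ratio_ge1; lra.
(* Concavity gives p'^a / s + 1 - 1/s <= p^a = q = q' / s + 1 - 1/s, hence p'^a <= q'. *)
have aa : ln q' / ln p' <= a.
  apply: ln_ratio_le; first by lra.
  have := powR_ge_chord1 _ a s^-1 p'; rewrite a0 a1 sV1 (ltW sV0) (ltW p'0).
  move=> /(_ isT isT isT); rewrite -pE powR_ln_ratio //; last by rewrite p0.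
  by rewrite [leRHS]qE lerD2r ler_pM2l.
(* As s, b >= 1, 1 - q' = s (1 - q) <= s^b (1 - p)^b = (1 - p')^b. *)
have bb : b <= ln (1 - q') / ln (1 - p').
  apply: ln_ratio_ge; [lra|lra|].
  rewrite qs ps powRM ?(ltW s0) ?subr_ge0 ?(ltW p1) //.
  rewrite powR_ln_ratio ?ler_pM2r ?le1r_powR ?subr_gt0 //; lra.
case: ifP => yp.
  apply: le_trans (Theta_ge_powR _ _ _ p'0 pq' q'1 _ y01).
  move: y0; rewrite le_eqVlt => /predU1P[<-|y0].
    by rewrite powR0 ?powR_ge0 // gt_eqF.
  by apply: ger_powR; rewrite ?y0.
apply: le_trans (Theta_ge_compl_powR _ _ _ p'0 pq' q'1 _ y01).
by rewrite lerD2l lerN2 compl_powR_mono //; lra.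
Qed.

(* The case where all the k-sets through a given point are present: the
   deletion has parameters s p = k / (n - 1) and s q = l / (n - 1). *)
Lemma Theta_above_p_le (R : realType) (p q s y : R) :
  0 < p -> p <= q -> 1 <= s -> s * q < 1 -> 0 <= y <= 1 ->
  Theta p q (p + (1 - p) * y) <= q + (1 - q) * Theta (s * p) (s * q) y.
Proof.
move=> p0 pq s1 sq1 y01.
have s0 : 0 < s by lra.
have sV0 : 0 < s^-1 by rewrite invr_gt0.
have sV1 : s^-1 <= 1 by rewrite invf_le1.
have sp0 : 0 < s * p by rewrite mulr_gt0.
have spq : s * p <= s * q by rewrite ler_pM2l.
have q0 : 0 < q by lra.
have qsq : q <= s * q by rewrite ler_peMl // ltW.
have q1 : q < 1 by lra.
rewrite Theta_above_p // lerD2l ler_pM2l ?subr_gt0 //; set b := ln _ / _.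
have b1 : 1 <= b by apply: ln_ratio_ge1; lra.
apply: le_trans (Theta_ge_compl_powR _ _ _ sp0 spq sq1 _ y01).
rewrite lerD2l lerN2 compl_powR_mono //; last by lra.
apply: ln_ratio_ge; [lra|lra|].
(* Since 1 - p averages 1 - s p (weight 1/s) and 1, convexity gives 1 - q <= (1 - s p)^b / s + 1 -
   1/s, that is, 1 - s q <= (1 - s p)^b. *)
have := powR_le_chord _ b s^-1 (1 - s * p) 1 b1.
rewrite sV1 (ltW sV0) ler01 subr_ge0 => /(_ isT ltac:(lra) isT).
rewrite powR1 !mulr1.
have -> : s^-1 * (1 - s * p) + (1 - s^-1) = 1 - p by field; rewrite gt_eqF.
rewrite powR_ln_ratio; [|lra|lra] => H.
rewrite -(ler_pM2l sV0) mulrBr mulr1 mulrA mulVf ?gt_eqF // mul1r; lra.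
Qed.

(** * Compressions *)

Section Compression.
Context {T : finType}.
Implicit Types (A B U V : {set T}) (F : {set {set T}}).

Definition movable V U A := (V \subset A) && [disjoint U & A].

Definition exchange V U A := (A :\: V) :|: U.

Definition compress V U F :=
  [set (if movable V U A && (exchange V U A \notin F) then exchange V U A else A)
     | A in F].

Definition compressed V U F :=
  forall A, A \in F -> movable V U A -> exchange V U A \in F.

Lemma exchangeK V U A : movable V U A -> exchange U V (exchange V U A) = A.
Proof.
move=> /andP[VA UA]; apply/setP => x; rewrite !inE.
have := subsetP VA x; have := disjointFr UA (x := x).
case: (x \in U); case: (x \in V); case: (x \in A) => //= h1 h2;
  do [by have := h1 isT | by have := h2 isT].
Qed.

Lemma movable_exchange V U A : [disjoint U & V] ->
  movable U V (exchange V U A).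
Proof.
move=> dUV; rewrite /movable subsetUr /=.
rewrite disjoints_subset; apply/subsetP => x xV.
by rewrite !inE xV (disjointFl dUV xV).
Qed.

Lemma movable_excl V U A : V != set0 -> movable V U A -> movable U V A = false.
Proof.
move=> V0 /andP[VA _]; apply/negbTE; rewrite negb_and; apply/orP; right.
have [x xV] := set0Pn _ V0; apply/negP => /disjointFr/(_ xV).
by rewrite (subsetP VA).
Qed.

Lemma card_exchange V U A : #|U| = #|V| -> movable V U A -> #|exchange V U A| = #|A|.
Proof.
move=> UV /andP[VA UA]; rewrite cardsU cardsD (setIidPr VA).
have -> : (A :\: V) :&: U = set0.
  apply/setP => x; rewrite !inE; case xU: (x \in U); rewrite ?andbF //.
  by rewrite (disjointFr UA xU) andbF.
by rewrite cards0 subn0 UV subnK // subset_leq_card.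
Qed.

Lemma card_compress V U F : [disjoint U & V] -> #|compress V U F| = #|F|.
Proof.
move=> dUV; apply: card_in_imset => A B AF BF.
case: ifP => [/andP[mA nA]|_]; case: ifP => [/andP[mB nB]|_] // E.
- by rewrite -(exchangeK _ _ _ mA) E exchangeK.
- by rewrite E BF in nA.
- by rewrite -E AF in nB.
Qed.

Lemma mem_compress V U F A : [disjoint U & V] -> A \in compress V U F ->
  A \in F \/ movable U V A /\ exchange U V A \in F.
Proof.
move=> dUV /imsetP[B BF ->]; case: ifP => [/andP[mB _]|_]; last by left.
by right; rewrite exchangeK //; split => //; apply: movable_exchange.
Qed.

Lemma mem_compress_movable V U F A : [disjoint U & V] -> V != set0 ->
  A \in compress V U F -> movable V U A -> exchange V U A \in F.
Proof.
move=> dUV V0 /imsetP[B BF ->]; case: ifP => [/andP[mB _] mm|].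
  by have := movable_excl _ _ _ V0 mm; rewrite movable_exchange.
by move=> + mB; rewrite mB /= => /negbFE.
Qed.

Lemma compress_stay V U F A : A \in F ->
  (movable V U A -> exchange V U A \in F) -> A \in compress V U F.
Proof.
move=> AF mA; apply/imsetP; exists A => //; case: ifP => // /andP[/mA ->] //.
Qed.

Lemma compress_exchange V U F A : [disjoint U & V] -> V != set0 ->
  movable U V A -> exchange U V A \in F -> A \in compress V U F.
Proof.
move=> dUV V0 mA mAF; have [AF|nAF] := boolP (A \in F).
  by apply: compress_stay => // /(movable_excl _ _ _ V0); rewrite mA.
apply/imsetP; exists (exchange U V A) => //.
by rewrite exchangeK // nAF movable_exchange // disjoint_sym.
Qed.

End Compression.

Lemma mem_upper_shadow n l (F : {set {set 'I_n}}) (A B : {set 'I_n}) :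
  A \in F -> A \subset B -> #|B| = l -> B \in upper_shadow l F.
Proof.
move=> AF AB Bl; rewrite !inE Bl eqxx /=.
by apply/existsP; exists A; rewrite AF.
Qed.

(** The last hypothesis is what minimality of the pair provides. It is needed when B meets V or U
    differently from the set A below it, so that moving all of V and U would leave B or its
    image. *)
Lemma upper_shadow_compress n l (F : {set {set 'I_n}}) (U V : {set 'I_n}) :
  [disjoint U & V] -> #|U| = #|V| -> U != set0 -> V != set0 ->
  (forall X : {set 'I_n}, X \subset V -> X != set0 ->
    exists2 Y : {set 'I_n}, Y \subset U & compressed (V :\: X) (U :\: Y) F) ->
  upper_shadow l (compress V U F) \subset compress V U (upper_shadow l F).
Proof.
move=> dUV UV U0 V0 H; apply/subsetP => B.
rewrite !inE => /andP[/eqP Bl /existsP[A /andP[AG AB]]].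
have AF := mem_compress _ _ _ _ dUV AG.
(* If B is movable, both B and its image must lie in the old shadow. *)
have [mB|mB] := boolP (movable V U B).
  have /andP[VB dUB] := mB.
  have dUA : [disjoint U & A] by rewrite disjoint_sym (disjointWl AB) // disjoint_sym.
  have {}AF : A \in F.
    case: AF => // -[/andP[UA _] _]; have [x xU] := set0Pn _ U0.
    by have := disjointFr dUA xU; rewrite (subsetP UA).
  apply: compress_stay; first exact: mem_upper_shadow AB Bl.
  move=> _; have [VA|nVA] := boolP (V \subset A).
    have mAF : exchange V U A \in F.
      by apply: mem_compress_movable AG _ => //; apply/andP.
    by apply: mem_upper_shadow mAF _ _; rewrite ?card_exchange // setSU // setSD.
  (* With this X the rest of V is its intersection with A, so the smaller compression applies to A,
     and the result lies inside the image of B. *)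
  have X0 : V :\: A != set0 by rewrite setD_eq0.
  have [Y YU cF] := H (V :\: A) (subsetDl _ _) X0.
  have /cF : movable (V :\: (V :\: A)) (U :\: Y) A.
    rewrite /movable setDDr setDv set0U subsetIr /=.
    exact: disjointWl (subsetDl _ _) dUA.
  move=> /(_ AF) mAF.
  apply: mem_upper_shadow mAF _ _; rewrite ?card_exchange //.
  apply/subsetP => x; rewrite !inE.
  by case xA: (x \in A); rewrite ?(subsetP AB x xA) /= ?andbT; case: (x \in V); case: (x \in U); rewrite ?orbT ?andbF.
have [mB'|mB'] := boolP (movable U V B).
  case: AF => [AF|[mA mAF]].
    by apply: compress_stay; rewrite ?(negbTE mB) //; exact: mem_upper_shadow AB Bl.
  apply: compress_exchange => //.
  by apply: mem_upper_shadow mAF _ _; rewrite ?card_exchange // setSU // setSD.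
apply: compress_stay; last by rewrite (negbTE mB).
case: AF => [AF|[mA mAF]]; first exact: mem_upper_shadow AB Bl.
have /andP[UA dVA] := mA; have UB := subset_trans UA AB.
(* B contains U but is not movable back, so it meets V. Removing only V \ B from the preimage of A
   and adding U \ Y gives a member of F inside B. *)
have X0 : V :&: B != set0 by move: mB'; rewrite /movable UB /= -setI_eq0.
have [Y YU cF] := H (V :&: B) (subsetIl _ _) X0.
have /cF : movable (V :\: (V :&: B)) (U :\: Y) (exchange U V A).
  apply/andP; split; first by rewrite (subset_trans (subsetDl _ _)) // subsetUr.
  rewrite disjoints_subset; apply/subsetP => x; rewrite !inE => /andP[_ xU].
  by rewrite xU (disjointFr dUV xU).
move=> /(_ mAF) {}mAF; apply: mem_upper_shadow mAF _ Bl.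
apply/subsetP => x; rewrite !inE.
have := subsetP AB x; have := subsetP UB x.
case: (x \in U); case: (x \in V); case: (x \in A); case: (x \in B) => //= h1 h2;
  do [by have := h1 isT | by have := h2 isT | by rewrite andbF].
Qed.

Lemma compressed_self (T : finType) (F : {set {set T}}) : compressed set0 set0 F.
Proof. by move=> A AF _; rewrite /exchange setD0 setU0. Qed.

Lemma subset_of_card (T : finType) (A : {set T}) m : (m <= #|A|)%N ->
  exists2 B : {set T}, B \subset A & #|B| = m.
Proof.
move=> /card_geqP[s [us <- sA]]; exists [set x in s]; last first.
  by rewrite cardsE; apply/card_uniqP.
by apply/subsetP => x; rewrite inE => /sA.
Qed.

(* Among the families of the same size and no larger shadow, take one with as
   many members containing [z] as possible; a compression with [z] in U that
   moves something would add one more. *)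
Lemma exists_compressed n k l (z : 'I_n) (F : {set {set 'I_n}}) :
  F \subset ksubsets n k ->
  exists G : {set {set 'I_n}}, [/\ G \subset ksubsets n k, #|G| = #|F|,
    (#|upper_shadow l G| <= #|upper_shadow l F|)%N &
    forall U V : {set 'I_n}, [disjoint U & V] -> #|U| = #|V| -> z \in U ->
      compressed V U G].
Proof.
move=> Fk.
pose P (G : {set {set 'I_n}}) := [&& G \subset ksubsets n k, #|G| == #|F| &
  (#|upper_shadow l G| <= #|upper_shadow l F|)%N].
pose w (G : {set {set 'I_n}}) := #|[set A in G | z \in A]|.
have PF : P F by rewrite /P Fk eqxx leqnn.
have [G /and3P[Gk /eqP GF Gl] Gmax] := @arg_maxnP _ F P w PF.
exists G; split => // U V.
(* Induction on the size of U: smaller pairs with z in the first set supply the hypothesis of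
   [upper_shadow_compress]. *)
have [m] := ubnP #|U|; elim: m U V => // m IH U V /ltnSE Um dUV UV zU.
have U0 : U != set0 by apply/set0Pn; exists z.
have V0 : V != set0 by rewrite -card_gt0 -UV card_gt0.
have H (X : {set 'I_n}) : X \subset V -> X != set0 ->
    exists2 Y : {set 'I_n}, Y \subset U & compressed (V :\: X) (U :\: Y) G.
  move=> XV X0; have [->|XnV] := eqVneq X V.
    by exists U => //; rewrite !setDv; exact: compressed_self.
  have XltV : (#|X| < #|V|)%N by rewrite proper_card // properEneq XnV.
  (* Y avoids z, so z stays in U \ Y and the induction hypothesis applies. *)
  have [|Y YU YX] := @subset_of_card _ (U :\ z) #|X|.
    by move: XltV; rewrite -UV (cardsD1 z U) zU.
  have YU' : Y \subset U := subset_trans YU (subsetDl _ _).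
  exists Y => //; apply: IH.
  - rewrite cardsD (setIidPr YU') YX; apply: leq_trans Um.
    by rewrite ltn_subrL !card_gt0 X0.
  - exact: disjointWl (subsetDl _ _) (disjointWr (subsetDl _ _) dUV).
  - by rewrite !cardsD (setIidPr YU') (setIidPr XV) YX UV.
  - rewrite inE zU andbT; apply/negP => /(subsetP YU).
    by rewrite !inE eqxx.
move=> A AG mA; apply: contraT => nmA.
have PG : P (compress V U G).
  rewrite /P card_compress // GF eqxx; apply/andP; split.
    apply/subsetP => B /imsetP[C CG ->].
    have := subsetP Gk _ CG; rewrite !inE; case: ifP => // /andP[mC _].
    by rewrite card_exchange.
  apply: leq_trans Gl; rewrite -(card_compress V U (upper_shadow l G)) //.
  exact: subset_leq_card (upper_shadow_compress _ _ _ _ _ dUV UV U0 V0 H).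
have /negP[] : ~~ (w G < w (compress V U G))%N by rewrite -leqNgt; exact: Gmax.
apply: proper_card.
apply/properP; split.
  apply/subsetP => B; rewrite !inE => /andP[BG zB]; rewrite zB andbT.
  apply: compress_stay => // /andP[_ /disjointFr/(_ zU)].
  by rewrite zB.
exists (exchange V U A); last by rewrite inE (negbTE nmA).
rewrite !inE zU orbT andbT; apply/imsetP; exists A => //.
by rewrite mA nmA.
Qed.

(** If some member A misses z, any k-set B through z arises from A by replacing A \ B with B \ A.
    These have equal size and z lies in B \ A, so B is in the compressed family. *)
Lemma exists_lex_at n k l (z : 'I_n) (F : {set {set 'I_n}}) :
  F \subset ksubsets n k ->
  exists G : {set {set 'I_n}}, [/\ G \subset ksubsets n k, #|G| = #|F|,
    (#|upper_shadow l G| <= #|upper_shadow l F|)%N &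
    (forall A, A \in G -> z \in A) \/
    (forall B, B \in ksubsets n k -> z \in B -> B \in G)].
Proof.
move=> Fk; have [G [Gk GF Gl cG]] := exists_compressed _ _ l z _ Fk.
exists G; split => //.
have [/existsP[A /andP[AG zA]]|] := boolP [exists A in G, z \notin A]; last first.
  rewrite negb_exists_in => /forall_inP allz; left => A /allz.
  by rewrite negbK.
right => B Bk zB.
have Ak := subsetP Gk _ AG; move: Ak Bk; rewrite !inE => /eqP Ak /eqP Bk.
have -> : B = exchange (A :\: B) (B :\: A) A.
  apply/setP => x; rewrite !inE.
  by case: (x \in A); case: (x \in B).
apply: (cG (B :\: A) (A :\: B)) => //.
- rewrite disjoints_subset; apply/subsetP => x; rewrite !inE.
  by case: (x \in A); case: (x \in B).
- by rewrite !cardsD Ak Bk setIC.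
- by rewrite inE zA zB.
- apply/andP; split; first exact: subsetDl.
  rewrite disjoints_subset; apply/subsetP => x; rewrite !inE.
  by case/andP.
Qed.

(** * Links and deletions at a point *)

Section LinkDeletion.
Context {m : nat}.
Implicit Types (F G : {set {set 'I_m.+1}}) (A : {set 'I_m}) (B : {set 'I_m.+1}).

Definition raise A : {set 'I_m.+1} := lift ord0 @: A.

Definition link F := [set A | ord0 |: raise A \in F].

Definition deletion F := [set A | raise A \in F].

Lemma mem_raise A i : (lift ord0 i \in raise A) = (i \in A).
Proof. by rewrite mem_imset //; exact: lift_inj. Qed.

Lemma ord0_raise A : (ord0 \in raise A) = false.
Proof. by apply/imsetP => -[i _ /eqP]; rewrite (negbTE (neq_lift _ _)). Qed.

Lemma card_raise A : #|raise A| = #|A|.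
Proof. by rewrite card_imset //; exact: lift_inj. Qed.

Lemma card_ord0_raise A : #|ord0 |: raise A| = #|A|.+1.
Proof. by rewrite cardsU1 ord0_raise card_raise. Qed.

Lemma raise_inj : injective raise.
Proof. by apply: imset_inj; exact: lift_inj. Qed.

Lemma raise_preimset B : raise (lift ord0 @^-1: B) = B :\ ord0.
Proof.
apply/setP => x; case: (unliftP ord0 x) => [j ->|->].
  by rewrite mem_raise !inE eq_sym (negbTE (neq_lift _ _)).
by rewrite ord0_raise !inE eqxx.
Qed.

Lemma card_link_deletion F : #|F| = (#|link F| + #|deletion F|)%N.
Proof.
have U1 (A : {set 'I_m}) : (ord0 |: raise A) :\ ord0 = raise A.
  by rewrite setU1K // ord0_raise.
rewrite -(cardsID [set B : {set 'I_m.+1} | ord0 \in B] F); congr (_ + _)%N.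
- rewrite -(@card_in_imset _ _ (fun A => ord0 |: raise A)); last first.
    by move=> A A' _ _ /(congr1 (fun B => B :\ ord0)); rewrite !U1 => /raise_inj.
  apply: eq_card => B; rewrite !inE; apply/andP/imsetP => [[BF zB]|[A]].
    have E : ord0 |: raise (lift ord0 @^-1: B) = B by rewrite raise_preimset setD1K.
    by exists (lift ord0 @^-1: B); rewrite ?inE E.
  by rewrite inE => AF ->; rewrite AF setU11.
- rewrite -(card_imset _ raise_inj).
  apply: eq_card => B; rewrite !inE; apply/andP/imsetP => [[zB BF]|[A]].
    have E : raise (lift ord0 @^-1: B) = B.
      rewrite raise_preimset; apply/setP => x; rewrite !inE.
      by case: eqVneq zB => // -> /negbTE ->.
    by exists (lift ord0 @^-1: B); rewrite ?inE E.
  by rewrite inE => AF ->; rewrite AF ord0_raise.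
Qed.

Lemma link_ksubsets k F : F \subset ksubsets m.+1 k.+1 -> link F \subset ksubsets m k.
Proof.
move=> /subsetP Fk; apply/subsetP => A; rewrite !inE => /Fk.
by rewrite inE card_ord0_raise.
Qed.

Lemma deletion_ksubsets k F : F \subset ksubsets m.+1 k -> deletion F \subset ksubsets m k.
Proof.
move=> /subsetP Fk; apply/subsetP => A; rewrite !inE => /Fk.
by rewrite inE card_raise.
Qed.

Lemma upper_shadow_link l F :
  upper_shadow l (link F) \subset link (upper_shadow l.+1 F).
Proof.
apply/subsetP => B; rewrite !inE => /andP[Bl /exists_inP[A]].
rewrite inE => AF AB; rewrite card_ord0_raise eqSS Bl.
by apply/exists_inP; exists (ord0 |: raise A); rewrite // setUS // imsetS.
Qed.

Lemma upper_shadow_deletion l F :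
  upper_shadow l (deletion F) \subset deletion (upper_shadow l F).
Proof.
apply/subsetP => B; rewrite !inE => /andP[Bl /exists_inP[A]].
rewrite inE => AF AB; rewrite card_raise Bl.
by apply/exists_inP; exists (raise A); rewrite // imsetS.
Qed.

End LinkDeletion.

(** * Measures and the induction on n *)

Lemma card_ksubsets n k : #|ksubsets n k| = 'C(n, k).
Proof. by rewrite card_draws card_ord. Qed.

Lemma upper_shadow_ksubsets n k l : (k <= l)%N ->
  upper_shadow l (ksubsets n k) = ksubsets n l.
Proof.
move=> kl; apply/setP => B; rewrite !inE; case: eqVneq => //= Bl.
have [|A AB Ak] := @subset_of_card _ B k; first by rewrite Bl.
by apply/exists_inP; exists A; rewrite // inE Ak.
Qed.

Lemma upper_shadow_subset n l (F : {set {set 'I_n}}) :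
  upper_shadow l F \subset ksubsets n l.
Proof. by apply/subsetP => B; rewrite inE => /andP[]. Qed.

Lemma mu_itv (R : realType) n k (F : {set {set 'I_n}}) : (k <= n)%N ->
  F \subset ksubsets n k -> 0 <= mu R k F <= 1.
Proof.
move=> kn /subset_leq_card; rewrite card_ksubsets => Fc.
by rewrite /mu divr_ge0 //= ler_pdivrMr ?ltr0n ?bin_gt0 // mul1r ler_nat.
Qed.

Lemma mu_ksubsets (R : realType) n k : (k <= n)%N -> mu R k (ksubsets n k) = 1.
Proof.
by move=> kn; rewrite /mu card_ksubsets divff // pnatr_eq0 -lt0n bin_gt0.
Qed.

(** Here p is the fraction of (k+1)-sets containing [ord0]; by Pascal's rule 1 - p is the fraction
    avoiding it. The bound k < m keeps both classes nonempty. *)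
Lemma mu_link_deletion (R : realType) m k (F : {set {set 'I_m.+1}}) :
  (k < m)%N ->
  let p : R := k.+1%:R / m.+1%:R in
  mu R k.+1 F = p * mu R k (link F) + (1 - p) * mu R k.+1 (deletion F).
Proof.
move=> km p; rewrite /mu card_link_deletion natrD.
have c0 : 'C(m.+1, k.+1)%:R != 0 :> R by rewrite pnatr_eq0 -lt0n bin_gt0 ltnW.
have c1 : 'C(m, k)%:R != 0 :> R by rewrite pnatr_eq0 -lt0n bin_gt0 ltnW.
have c2 : 'C(m, k.+1)%:R != 0 :> R by rewrite pnatr_eq0 -lt0n bin_gt0.
have m0 : m.+1%:R != 0 :> R by rewrite pnatr_eq0.
have E1 : p = 'C(m, k)%:R / 'C(m.+1, k.+1)%:R.
  apply/eqP; rewrite eqr_div // -!natrM eqr_nat mulnC.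
  by rewrite [X in _ == X]mulnC mul_bin_diag mulnC.
have E2 : 1 - p = 'C(m, k.+1)%:R / 'C(m.+1, k.+1)%:R.
  by rewrite E1 binS natrD; field; rewrite -natrD -binS.
by rewrite E2 E1; field; rewrite c0 c1 c2.
Qed.

Lemma mu_subset (R : realType) n k (F G : {set {set 'I_n}}) :
  F \subset G -> mu R k F <= mu R k G.
Proof. by move=> FG; rewrite /mu ler_wpM2r ?invr_ge0 // ler_nat subset_leq_card. Qed.

Lemma Theta_mu_le (R : realType) n k l (F : {set {set 'I_n}}) :
  (1 <= k)%N -> (k <= l)%N -> (l < n)%N -> F \subset ksubsets n k ->
  Theta (k%:R / n%:R) (l%:R / n%:R) (mu R k F) <= mu R l (upper_shadow l F).
Proof.
elim: n k l F => // m IH [//|k] [//|l] F _ kl lm Fk.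
move: (kl) (lm); rewrite !ltnS => kl' lm'.
have km : (k < m)%N by exact: leq_trans lm'.
have lm1 : (l.+1 <= m.+1)%N by rewrite ltnW.
have [G [Gk GF Gl Glex]] := exists_lex_at _ _ l.+1 ord0 _ Fk.
set p := k.+1%:R / _; set q := l.+1%:R / _.
have -> : mu R k.+1 F = mu R k.+1 G by rewrite /mu GF.
have m0 : 0 < m%:R :> R by rewrite ltr0n (leq_trans _ km).
have m1 : 0 < m.+1%:R :> R by rewrite ltr0n.
have p0 : 0 < p by rewrite divr_gt0 ?ltr0n.
have q0 : 0 < q by rewrite divr_gt0 ?ltr0n.
have pq : p <= q by rewrite ler_pM2r ?invr_gt0 // ler_nat.
have q1 : q < 1 by rewrite ltr_pdivrMr // mul1r ltr_nat.
have s1 : 1 <= m.+1%:R / m%:R :> R by rewrite ler_pdivlMr // mul1r ler_nat.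
have sp : m.+1%:R / m%:R * p = k.+1%:R / m%:R.
  by rewrite /p mulrC mulrA divfK // gt_eqF.
have sq : m.+1%:R / m%:R * q = l.+1%:R / m%:R.
  by rewrite /q mulrC mulrA divfK // gt_eqF.
have shF : mu R l.+1 (upper_shadow l.+1 G) <= mu R l.+1 (upper_shadow l.+1 F).
  by rewrite /mu ler_pM2r ?invr_gt0 ?ltr0n ?bin_gt0 // ler_nat.
apply: le_trans shF.
(* It suffices to bound the average of the shadow measures of the link and the deletion. *)
have : q * mu R l (upper_shadow l (link G)) +
   (1 - q) * mu R l.+1 (upper_shadow l.+1 (deletion G)) <=
     mu R l.+1 (upper_shadow l.+1 G).
  rewrite (mu_link_deletion R _ _ (upper_shadow _ _) lm') -/q.
  apply: lerD; rewrite ler_wpM2l ?subr_ge0 ?(ltW q1) ?(ltW q0) //.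
    by apply: mu_subset; exact: upper_shadow_link.
  by apply: mu_subset; exact: upper_shadow_deletion.
apply: le_trans.
rewrite (mu_link_deletion R _ _ G km) -/p.
have lk := link_ksubsets _ _ Gk.
have dk := deletion_ksubsets _ _ Gk.
have yl : 0 <= mu R k (link G) <= 1 by apply: mu_itv => //; exact: ltnW.
have yd : 0 <= mu R k.+1 (deletion G) <= 1 by exact: mu_itv.
have q'0 : 0 <= 1 - q by lra.
have mus0 j (S : {set {set 'I_m}}) : 0 <= mu R j S by rewrite divr_ge0.
case: Glex => [allz|full].
- have d0 : deletion G = set0.
    by apply/setP => A; rewrite !inE; apply/negP => /allz; rewrite ord0_raise.
  rewrite [X in _ + (1 - p) * X](_ : _ = 0) ?mulr0 ?addr0; last first.
    by rewrite /mu d0 cards0 mul0r.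
  apply: (@le_trans _ _ (q * mu R l (upper_shadow l (link G)))); last first.
    by rewrite lerDl mulr_ge0.
  (* For k = 0 the link would have parameter p' = 0, outside the range of [Theta]; but it is then
     empty or consists of the empty set alone. *)
  have [k0|k0] := posnP k.
    have [->|[A AL]] := set_0Vmem (link G).
      by rewrite {1}/mu cards0 mul0r mulr0 Theta0 // mulr_ge0 // ltW.
    have -> : link G = ksubsets m k.
      apply/eqP; rewrite eqEsubset lk; apply/subsetP => A'.
      move: (subsetP lk _ AL); rewrite !inE k0 !cards_eq0 => /eqP AE /eqP ->.
      by rewrite inE AE in AL.
    by rewrite upper_shadow_ksubsets // !mu_ksubsets ?(ltnW km) ?(ltnW lm') // !mulr1 Theta_at_p.
  have IHl := IH _ _ _ k0 kl' lm' lk.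
  have q1' : l%:R / m%:R < 1 :> R by rewrite ltr_pdivrMr // mul1r ltr_nat.
  apply: le_trans (_ : _ <= q * Theta (k%:R / m%:R) (l%:R / m%:R) (mu R k (link G))) _; last first.
    by rewrite ler_pM2l.
  apply: (@Theta_mul_p_le _ _ _ _ _ (m.+1%:R / m%:R)) => //.
  + by rewrite divr_gt0 // ltr0n.
  + by rewrite ler_pM2r ?invr_gt0 // ler_nat.
  + by rewrite mulrBr mulr1 sp -!natr1; field; rewrite gt_eqF.
  + by rewrite mulrBr mulr1 sq -!natr1; field; rewrite gt_eqF.
- have lE : link G = ksubsets m k.
    apply/eqP; rewrite eqEsubset lk; apply/subsetP => A; rewrite !inE => Ak.
    by apply: full; rewrite ?setU11 // inE card_ord0_raise eqSS.
  rewrite lE upper_shadow_ksubsets // !mu_ksubsets ?(ltnW km) ?(ltnW lm') // !mulr1.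
  (* The induction hypothesis requires l.+1 < m. Otherwise l.+1 = m, the shadow of a nonempty
     deletion is the full set alone, and [Theta_le1] suffices. *)
  have [lm2|ml] := ltnP l.+1 m.
    have sq1 : m.+1%:R / m%:R * q < 1 by rewrite sq ltr_pdivrMr // mul1r ltr_nat.
    apply: le_trans (Theta_above_p_le _ _ _ _ _ p0 pq s1 sq1 yd) _.
    by rewrite lerD2l ler_wpM2l // sp sq; exact: IH.
  have [->|[A AD]] := set_0Vmem (deletion G).
    by rewrite {1}/mu cards0 mul0r mulr0 addr0 Theta_at_p // lerDl mulr_ge0.
  have lmE : l.+1 = m by apply/eqP; rewrite eqn_leq lm' ml.
  have -> : upper_shadow l.+1 (deletion G) = ksubsets m l.+1.
    apply/setP => B; rewrite !inE; case: eqVneq => //= Bl.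
    have -> : B = setT by apply/eqP; rewrite eqEcard subsetT cardsT card_ord Bl lmE leqnn.
    by apply/exists_inP; exists A; rewrite ?subsetT.
  rewrite mu_ksubsets // mulr1 [leRHS]addrC subrK Theta_le1 // lerDl mulr_ge0 //.
    by lra.
Qed.

Theorem theorem1p2 (R : realType) (n k l : nat)
    (hk : (1 <= k)%N) (hkl : (k <= l)%N) (hln : (l < n)%N)
    (F : {set {set 'I_n}}) (hF : F \subset ksubsets n k) :
  mu R l (upper_shadow l F) >= Theta (k%:R / n%:R) (l%:R / n%:R) (mu R k F).
Proof. exact: Theta_mu_le. Qed.
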